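(* Let $R$ be a commutative unital ring, let $S \subseteq R$ be a multiplicatively closed subset, let $m,n \in \mathbb{N}_0$, and let $A \in R^{m \times n}$ and $b \in R^{1 \times n}$. Then there exists $\frac{x}{d} \in (S^{-1}R)^{1 \times m}$ (with $x \in R^{1 \times m}$ and $d \in S$) such that $\frac{x}{d} \cdot \frac{A}{1} = \frac{b}{1}$ over $S^{-1}R$ if and only if there exists an element $r \in \mathrm{ann}_R([b]_A) \cap S$.
   Context: A subset $S \subseteq R$ is multiplicatively closed if $1 \in S$ and $r,s \in S$ implies $rs \in S$. For a matrix $A$ over $R$ and $d \in S$, $\frac{A}{d}$ denotes the matrix over $S^{-1}R$ with entries $\frac{A_{ij}}{d}$. $\mathbb{N}_0$ denotes the non-negative integers. For $A \in R^{m \times n}$ and $b \in R^{1 \times n}$ one sets $$\mathrm{ann}_R([b]_A) := \{ r \in R \mid \exists x \in R^{1 \times m} : xA = rb \} \subseteq R.$$ *)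

(* Defs.v *)
From HB Require Import structures.
From mathcomp Require Import all_boot all_algebra.
From mathcomp Require Import boolp classical_sets.
From mathcomp Require Import ring.

Set Implicit Arguments.
Unset Strict Implicit.
Unset Printing Implicit Defensive.

Import GRing.Theory.

Local Open Scope classical_set_scope.
Local Open Scope ring_scope.
Local Open Scope quotient_scope.

(* Rings are [comPzRingType]s, so the zero ring is allowed.  This matters for
   the localization, which is the zero ring as soon as 0 lies in S. *)

Definition mult_closed (R : comPzRingType) (S : set R) : Prop :=
  S 1 /\ (forall r s : R, S r -> S s -> S (r * s)).

Module Localization.
Section Construction.

Variables (R : comPzRingType) (S : set R).
Hypothesis hS : mult_closed S.

Lemma den1_subproof : (1 : R) \in S.
Proof. by rewrite inE; case: hS. Qed.

Lemma denM_subproof (d e : S) : sval d * sval e \in S.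
Proof.
by rewrite inE; case: hS => _; apply; [have := valP d | have := valP e];
  rewrite inE.
Qed.

Definition den1 : S := exist _ 1 den1_subproof.
Definition denM (d e : S) : S := exist _ (sval d * sval e) (denM_subproof d e).

(* A pair (r, d) stands for r / d.  The factor t cannot be dropped, because
   S may contain zero divisors. *)
Definition equivl (x y : R * S) : bool :=
  `[< exists t : S, sval t * (x.1 * sval y.2) = sval t * (y.1 * sval x.2) >].

Lemma equivl_refl : reflexive equivl.
Proof. by move=> x; apply/asboolP; exists den1. Qed.

Lemma equivl_sym : symmetric equivl.
Proof.
by move=> x y; apply/asboolP/asboolP => -[t e]; exists t; rewrite e.
Qed.

Lemma equivl_trans : transitive equivl.
Proof.
move=> [y b] [x a] [z c] /asboolP[t /= e] /asboolP[u /= f].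
apply/asboolP; exists (denM (denM t u) b) => /=.
transitivity (sval u * sval c * (sval t * (x * sval b))); first by ring.
rewrite e.
transitivity (sval t * sval a * (sval u * (y * sval c))); first by ring.
by rewrite f; ring.
Qed.

Canonical equivl_equiv := EquivRel equivl equivl_refl equivl_sym equivl_trans.

Definition type := {eq_quot equivl}.

HB.instance Definition _ : EqQuotient _ equivl type := EqQuotient.on type.
HB.instance Definition _ := Choice.on type.

Definition frac (r : R) (d : S) : type := \pi_type (r, d).

Lemma fracP (r r' : R) (d d' : S) :
  frac r d = frac r' d' <->
  exists t : S, sval t * (r * sval d') = sval t * (r' * sval d).
Proof.
split; first by move=> /eqmodP /asboolP.
by move=> h; apply/eqmodP/asboolP.
Qed.

Lemma fracW (P : type -> Prop) : (forall r d, P (frac r d)) -> forall a, P a.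
Proof. by move=> h; elim/quotW=> -[r d]; exact: h. Qed.

Definition add (a b : type) : type :=
  let x := repr a in let y := repr b in
  frac (x.1 * sval y.2 + y.1 * sval x.2) (denM x.2 y.2).
Definition opp (a : type) : type := let x := repr a in frac (- x.1) x.2.
Definition mul (a b : type) : type :=
  let x := repr a in let y := repr b in
  frac (x.1 * y.1) (denM x.2 y.2).

Lemma repr_frac (r : R) (d : S) :
  exists t : S,
    sval t * ((repr (frac r d)).1 * sval d)
    = sval t * (r * sval (repr (frac r d)).2).
Proof. by apply/fracP; rewrite /frac -surjective_pairing reprK. Qed.

Lemma addE (r s : R) (d e : S) :
  add (frac r d) (frac s e) = frac (r * sval e + s * sval d) (denM d e).
Proof.
rewrite /add; have [t] := repr_frac r d; have [u] := repr_frac s e.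
move: (repr _) (repr _) => [x a] [y b] /= hy hx.
apply/fracP; exists (denM t u) => /=.
transitivity (sval u * sval b * sval e * (sval t * (x * sval d))
  + sval t * sval a * sval d * (sval u * (y * sval e))); first by ring.
by rewrite hx hy; ring.
Qed.

Lemma oppE (r : R) (d : S) : opp (frac r d) = frac (- r) d.
Proof.
rewrite /opp; have [t] := repr_frac r d.
move: (repr _) => [x a] /= hx.
by apply/fracP; exists t => /=; rewrite !mulNr !mulrN hx.
Qed.

Lemma mulE (r s : R) (d e : S) :
  mul (frac r d) (frac s e) = frac (r * s) (denM d e).
Proof.
rewrite /mul; have [t] := repr_frac r d; have [u] := repr_frac s e.
move: (repr _) (repr _) => [x a] [y b] /= hy hx.
apply/fracP; exists (denM t u) => /=.
transitivity ((sval t * (x * sval d)) * (sval u * (y * sval e))); first by ring.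
by rewrite hx hy; ring.
Qed.

Lemma addA : associative add.
Proof.
elim/fracW=> x a; elim/fracW=> y b; elim/fracW=> z c; rewrite !addE.
by apply/fracP; exists den1 => /=; ring.
Qed.

Lemma addC : commutative add.
Proof.
elim/fracW=> x a; elim/fracW=> y b; rewrite !addE.
by apply/fracP; exists den1 => /=; ring.
Qed.

Lemma add0 : left_id (frac 0 den1) add.
Proof.
by elim/fracW=> x a; rewrite !addE; apply/fracP; exists den1 => /=; ring.
Qed.

Lemma addN : left_inverse (frac 0 den1) opp add.
Proof.
elim/fracW=> x a; rewrite oppE !addE.
by apply/fracP; exists den1 => /=; ring.
Qed.

HB.instance Definition _ := GRing.isZmodule.Build type addA addC add0 addN.

Lemma mulA : associative mul.
Proof.
elim/fracW=> x a; elim/fracW=> y b; elim/fracW=> z c; rewrite !mulE.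
by apply/fracP; exists den1 => /=; ring.
Qed.

Lemma mulC : commutative mul.
Proof.
elim/fracW=> x a; elim/fracW=> y b; rewrite !mulE.
by apply/fracP; exists den1 => /=; ring.
Qed.

Lemma mul1 : left_id (frac 1 den1) mul.
Proof.
by elim/fracW=> x a; rewrite !mulE; apply/fracP; exists den1 => /=; ring.
Qed.

Lemma mulDl : left_distributive mul add.
Proof.
elim/fracW=> x a; elim/fracW=> y b; elim/fracW=> z c.
rewrite addE !mulE addE.
by apply/fracP; exists den1 => /=; ring.
Qed.

HB.instance Definition _ :=
  GRing.Zmodule_isComPzRing.Build type mulA mulC mul1 mulDl.

Lemma fracD (r s : R) (d e : S) :
  frac r d + frac s e = frac (r * sval e + s * sval d) (denM d e).
Proof. exact: addE. Qed.

Lemma fracN (r : R) (d : S) : - frac r d = frac (- r) d.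
Proof. exact: oppE. Qed.

Lemma fracM (r s : R) (d e : S) :
  frac r d * frac s e = frac (r * s) (denM d e).
Proof. exact: mulE. Qed.

Lemma frac0 : frac 0 den1 = 0. Proof. by []. Qed.

Lemma frac1 : frac 1 den1 = 1. Proof. by []. Qed.

End Construction.
End Localization.
HB.export Localization.

(* The ring S^{-1}R. *)
Notation localization := Localization.type.

(* [fracmx hS A d] is A / d, and [fracmx hS A (den1 hS)] is A / 1. *)
Definition fracmx (R : comPzRingType) (S : set R) (hS : mult_closed S)
    (m n : nat) (A : 'M[R]_(m, n)) (d : S) : 'M[localization hS]_(m, n) :=
  \matrix_(i, j) Localization.frac hS (A i j) d.

Notation den1 := Localization.den1.

Definition ann (R : comPzRingType) (m n : nat)
    (A : 'M[R]_(m, n)) (b : 'rV[R]_n) : set R :=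
  [set r | exists x : 'rV[R]_m, x *m A = r *: b].

(* Main.v *)
Require Import Defs.
From mathcomp Require Import all_boot all_algebra.
From mathcomp Require Import boolp classical_sets.
From mathcomp Require Import ring.

Import GRing.Theory.

Local Open Scope classical_set_scope.
Local Open Scope ring_scope.

(** Clear denominators. The equation says that [x *m A] over [d] equals [b] over 1, that is,
    [(t x) A = (t d) b] for some [t] in [S], so [t d] is the element sought; conversely, [x A = r b]
    with [r] in [S] is solved by [x / r]. [fracmxM] gives the product a single denominator, and
    [fracmxP] finds one [t] for all entries at once. *)

Section FractionMatrices.

Variables (R : comPzRingType) (S : set R) (hS : mult_closed S).

Lemma den_in (d : S) : S (sval d).
Proof. exact: set_mem (valP d). Qed.

Lemma mult_closed_prod (I : finType) (t : I -> R) :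
  (forall i, S (t i)) -> S (\prod_i t i).
Proof. by case: hS => S1 SM St; apply: (big_ind S). Qed.

(** Each addition multiplies denominators, but the surplus factor [d] cancels in the localization,
    so a common denominator survives. *)
Lemma frac_sum (I : finType) (F : I -> R) (d : S) :
  \sum_i Localization.frac hS (F i) d = Localization.frac hS (\sum_i F i) d.
Proof.
elim/big_rec2: _ => [|i y z _ ->].
  (* The empty sum is 0/1, to be identified with 0/d. *)
  by apply/Localization.fracP; exists (den1 hS) => /=; ring.
rewrite Localization.fracD; apply/Localization.fracP.
by exists (den1 hS) => /=; ring.
Qed.

Lemma fracmxM m n p (A : 'M[R]_(m, n)) (B : 'M[R]_(n, p)) (d e : S) :
  fracmx hS A d *m fracmx hS B e
  = fracmx hS (A *m B) (Localization.denM hS d e).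
Proof.
apply/matrixP => i j; rewrite !mxE -frac_sum; apply: eq_bigr => k _.
by rewrite !mxE Localization.fracM.
Qed.

Lemma fracmxP m n (A B : 'M[R]_(m, n)) (d e : S) :
  fracmx hS A d = fracmx hS B e <->
  exists t : R, S t /\ (t * sval e) *: A = (t * sval d) *: B.
Proof.
split=> [eqAB | [t [St eqAB]]]; last first.
  apply/matrixP => i j; rewrite !mxE; apply/Localization.fracP.
  exists (exist _ t (mem_set St)) => /=.
  by have /matrixP/(_ i j) := eqAB; rewrite !mxE => eq_ij; ring: eq_ij.
have /choice[t tE] (ij : 'I_m * 'I_n) : exists t : S,
    sval t * (A ij.1 ij.2 * sval e) = sval t * (B ij.1 ij.2 * sval d).
  by apply/Localization.fracP; have /matrixP/(_ ij.1 ij.2) := eqAB; rewrite !mxE.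
(* The product of the witnesses of the finitely many entries serves them all. *)
exists (\prod_ij sval (t ij)); split.
  by apply: mult_closed_prod => ij; exact: den_in.
(* Once the factor for [(i, j)] is split off, the others only scale that entry's equation. *)
apply/matrixP => i j; rewrite !mxE (bigD1 (i, j)) //=.
by have /= eq_ij := tE (i, j); ring: eq_ij.
Qed.

End FractionMatrices.

Theorem lemma3p5 (R : comPzRingType) (S : set R) (hS : mult_closed S)
    (m n : nat) (A : 'M[R]_(m, n)) (b : 'rV[R]_n) :
  (exists (x : 'rV[R]_m) (d : S),
      fracmx hS x d *m fracmx hS A (den1 hS) = fracmx hS b (den1 hS))
  <-> (exists r : R, (ann A b `&` S) r).
Proof.
split=> [[x [d]] | [r [[x xA] Sr]]].
  rewrite fracmxM => /fracmxP[t [St /= eq_xA]]; exists (t * sval d); split.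
    by exists (t *: x); move: eq_xA; rewrite !mulr1 scalemxAl.
  by case: hS => _; apply=> //; exact: den_in.
exists x, (exist _ r (mem_set Sr)); rewrite fracmxM; apply/fracmxP.
by exists 1; split; [case: hS | rewrite /= !mulr1 !mul1r scale1r].
Qed.
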